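(* Let $A\in\mathbb{H}^{m\times m}$ with $\operatorname{Ind}(A)=k$. Then the Drazin inverse $A^D$ of $A$ is given by $$A^{D}=A^{(2)}_{l,(A^k,A^k)}=A^{(2)}_{r,(A^k,A^k)}.$$
   Context: $\mathbb{H}$ denotes the real quaternions. The rank of a quaternion matrix is the maximal number of right linearly independent columns (equivalently, of left linearly independent rows). For $A\in\mathbb{H}^{m\times m}$, $\operatorname{Ind}(A)$ is the smallest integer $k\ge 0$ with $\operatorname{rank}(A^{k+1})=\operatorname{rank}(A^k)$. The Drazin inverse $A^D$ of $A$ with $\operatorname{Ind}(A)=k$ is the unique $X\in\mathbb{H}^{m\times m}$ with $A^{k+1}X=A^k$, $XAX=X$, $AX=XA$. For $B\in\mathbb{H}^{m\times n}$: $\mathcal{R}_r(B)=\{Bx : x\in\mathbb{H}^{n\times 1}\}$, $\mathcal{N}_r(B)=\{x\in\mathbb{H}^{n\times 1} : Bx=0\}$, $\mathcal{R}_l(B)=\{xB : x\in\mathbb{H}^{1\times m}\}$, $\mathcal{N}_l(B)=\{x\in\mathbb{H}^{1\times m} : xB=0\}$. $A^{(2)}_{r,(S,T)}$ denotes the matrix $X$ with $XAX=X$, $\mathcal{R}_r(X)=\mathcal{R}_r(S)$, $\mathcal{N}_r(X)=\mathcal{N}_r(T)$; $A^{(2)}_{l,(S,T)}$ denotes the matrix $X$ with $XAX=X$, $\mathcal{R}_l(X)=\mathcal{R}_l(S)$, $\mathcal{N}_l(X)=\mathcal{N}_l(T)$ (each is unique when it exists). *)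

(* Defs.v *)
From HB Require Export structures.
From mathcomp Require Export all_boot all_order all_algebra.
From mathcomp Require Export boolp classical_sets reals.
From mathcomp Require Import ring.
Set Implicit Arguments.
Unset Strict Implicit.
Unset Printing Implicit Defensive.
Import Order.TTheory GRing.Theory Num.Theory.
Local Open Scope ring_scope.

(* [Quat a b c d] is a + b i + c j + d k. *)
Record quaternion (R : realType) : Type := Quat {
  q1 : R; qi : R; qj : R; qk : R }.

Definition quat_to_tuple (R : realType) (x : quaternion R) : R * R * R * R :=
  (q1 x, qi x, qj x, qk x).

Definition quat_of_tuple (R : realType) (t : R * R * R * R) : quaternion R :=
  let: (a, b, c, d) := t in Quat a b c d.

Lemma quat_to_tupleK (R : realType) :
  cancel (@quat_to_tuple R) (@quat_of_tuple R).
Proof. by case. Qed.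

HB.instance Definition _ (R : realType) :=
  Choice.copy (quaternion R) (can_type (@quat_to_tupleK R)).

Definition addq (R : realType) (x y : quaternion R) : quaternion R :=
  Quat (q1 x + q1 y) (qi x + qi y) (qj x + qj y) (qk x + qk y).

Definition oppq (R : realType) (x : quaternion R) : quaternion R :=
  Quat (- q1 x) (- qi x) (- qj x) (- qk x).

(* Hamilton product: i^2 = j^2 = k^2 = ijk = -1. *)
Definition mulq (R : realType) (x y : quaternion R) : quaternion R :=
  Quat (q1 x * q1 y - qi x * qi y - qj x * qj y - qk x * qk y)
       (q1 x * qi y + qi x * q1 y + qj x * qk y - qk x * qj y)
       (q1 x * qj y - qi x * qk y + qj x * q1 y + qk x * qi y)
       (q1 x * qk y + qi x * qj y - qj x * qi y + qk x * q1 y).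

Lemma addqA (R : realType) : associative (@addq R).
Proof. by move=> x y z; congr Quat; rewrite /= addrA. Qed.

Lemma addqC (R : realType) : commutative (@addq R).
Proof. by move=> x y; congr Quat; rewrite /= addrC. Qed.

Lemma add0q (R : realType) : left_id (Quat 0 0 0 0) (@addq R).
Proof. by case=> a b c d; congr Quat; rewrite /= add0r. Qed.

Lemma addNq (R : realType) : left_inverse (Quat 0 0 0 0) (@oppq R) (@addq R).
Proof. by move=> x; congr Quat; rewrite /= addNr. Qed.

HB.instance Definition _ (R : realType) :=
  GRing.isZmodule.Build (quaternion R)
    (@addqA R) (@addqC R) (@add0q R) (@addNq R).

Lemma mulqA (R : realType) : associative (@mulq R).
Proof. by move=> x y z; congr Quat; rewrite /=; ring. Qed.

Lemma mul1q (R : realType) : left_id (Quat 1 0 0 0) (@mulq R).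
Proof. by case=> a b c d; congr Quat; rewrite /=; ring. Qed.

Lemma mulq1 (R : realType) : right_id (Quat 1 0 0 0) (@mulq R).
Proof. by case=> a b c d; congr Quat; rewrite /=; ring. Qed.

Lemma mulqDl (R : realType) : left_distributive (@mulq R) (@addq R).
Proof. by move=> x y z; congr Quat; rewrite /=; ring. Qed.

Lemma mulqDr (R : realType) : right_distributive (@mulq R) (@addq R).
Proof. by move=> x y z; congr Quat; rewrite /=; ring. Qed.

Lemma oneq_neq0 (R : realType) : (Quat 1 0 0 0 : quaternion R) != 0.
Proof. by apply/eqP => -[/eqP]; rewrite oner_eq0. Qed.

HB.instance Definition _ (R : realType) :=
  GRing.Zmodule_isNzRing.Build (quaternion R)
    (@mulqA R) (@mul1q R) (@mulq1 R) (@mulqDl R) (@mulqDr R) (@oneq_neq0 R).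

(* The coefficients multiply the columns on the right. *)
Definition right_indep_cols (R : realType) (m n : nat)
    (A : 'M[quaternion R]_(m, n)) (J : {set 'I_n}) : Prop :=
  forall c : 'I_n -> quaternion R,
    (forall i : 'I_m, \sum_(j in J) A i j * c j = 0) ->
    forall j : 'I_n, j \in J -> c j = 0.

Definition qrank (R : realType) (m n : nat)
    (A : 'M[quaternion R]_(m, n)) : nat :=
  (\max_(J : {set 'I_n} | `[< right_indep_cols A J >]) #|J|)%N.

(* Ind(A) = k *)
Definition has_index (R : realType) (m : nat)
    (A : 'M[quaternion R]_m) (k : nat) : Prop :=
  qrank (A ^+ k.+1) = qrank (A ^+ k) /\
  (forall j : nat, qrank (A ^+ j.+1) = qrank (A ^+ j) -> (k <= j)%N).

Definition is_drazin (R : realType) (m : nat)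
    (A X : 'M[quaternion R]_m) : Prop :=
  exists2 k : nat, has_index A k &
    [/\ A ^+ k.+1 *m X = A ^+ k, X *m A *m X = X & A *m X = X *m A].

Definition range_r (R : realType) (m n : nat)
    (B : 'M[quaternion R]_(m, n)) : set 'cV[quaternion R]_m :=
  [set y | exists x : 'cV[quaternion R]_n, y = B *m x].

Definition null_r (R : realType) (m n : nat)
    (B : 'M[quaternion R]_(m, n)) : set 'cV[quaternion R]_n :=
  [set x | B *m x = 0].

Definition range_l (R : realType) (m n : nat)
    (B : 'M[quaternion R]_(m, n)) : set 'rV[quaternion R]_n :=
  [set y | exists x : 'rV[quaternion R]_m, y = x *m B].

Definition null_l (R : realType) (m n : nat)
    (B : 'M[quaternion R]_(m, n)) : set 'rV[quaternion R]_m :=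
  [set x | x *m B = 0].

(* X satisfies the conditions defining A^(2)_{r,(S,T)}. *)
Definition is_outer_r (R : realType) (m n p q : nat)
    (A : 'M[quaternion R]_(m, n)) (S : 'M[quaternion R]_(n, p))
    (T : 'M[quaternion R]_(q, m)) (X : 'M[quaternion R]_(n, m)) : Prop :=
  [/\ X *m A *m X = X, range_r X = range_r S & null_r X = null_r T].

(* X satisfies the conditions defining A^(2)_{l,(S,T)}. *)
Definition is_outer_l (R : realType) (m n p q : nat)
    (A : 'M[quaternion R]_(m, n)) (S : 'M[quaternion R]_(p, m))
    (T : 'M[quaternion R]_(n, q)) (X : 'M[quaternion R]_(n, m)) : Prop :=
  [/\ X *m A *m X = X, range_l X = range_l S & null_l X = null_l T].

(* Main.v *)
(** The column rank of [A ^+ k] being [r], write [A ^+ k = B *m C] with [B] made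
of [r] right independent columns.  Since [A *m B] lies in the right span of
[B], [A *m B = B *m G] for a square [G], and [rank (A ^+ k.+1) = r] forces [G]
to be invertible, with inverse [H].  Cancelling [B] on the left gives
[C *m B = G ^+ k] and [C *m A = G *m C], so that [B *m H ^+ k.+1 *m C] is the
Drazin inverse.  Everything else is ring algebra: [X = X ^+ k.+1 * A ^+ k] and
[A ^+ k = X * A ^+ k.+1], together with their mirror images, identify the
ranges and null spaces of [X] and [A ^+ k]; and two outer inverses [X], [Y] with
the same range and null space satisfy [Y A X = X] and [Y A X = Y]. *)
Require Import Defs.
From mathcomp Require Import ring.
Set Implicit Arguments.
Unset Strict Implicit.
Unset Printing Implicit Defensive.
Import Order.TTheory GRing.Theory Num.Theory.
Local Open Scope classical_set_scope.
Local Open Scope ring_scope.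

(** * The quaternions as a division ring *)

Section QuaternionInverse.
Variable R : realType.
Implicit Types x y : quaternion R.

Definition normsqq x : R := q1 x ^+ 2 + qi x ^+ 2 + qj x ^+ 2 + qk x ^+ 2.

(** Conjugate over squared norm; the value 0 at 0 meets the convention that inversion fixes
    non-units. *)
Definition invq x : quaternion R :=
  if x == 0 then 0 else
  Quat (q1 x / normsqq x) (- qi x / normsqq x) (- qj x / normsqq x)
       (- qk x / normsqq x).

Lemma normsqq_eq0 x : (normsqq x == 0) = (x == 0).
Proof.
apply/eqP/eqP => [|->]; last by rewrite /normsqq /= expr0n /= !addr0.
case: x => a b c d; rewrite /normsqq /= => /eqP.
rewrite !paddr_eq0 ?addr_ge0 ?sqr_ge0// !sqrf_eq0.
by move=> /andP[/andP[/andP[/eqP-> /eqP->] /eqP->] /eqP->].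
Qed.

Lemma mulVq : {in [pred x : quaternion R | x != 0], left_inverse 1 invq *%R}.
Proof.
move=> x; rewrite inE => x0; have := x0; rewrite -normsqq_eq0 /invq (negbTE x0).
by case: x {x0} => a b c d; rewrite /normsqq /= => n0; congr Quat => /=; field.
Qed.

Lemma mulqV : {in [pred x : quaternion R | x != 0], right_inverse 1 invq *%R}.
Proof.
move=> x; rewrite inE => x0; have := x0; rewrite -normsqq_eq0 /invq (negbTE x0).
by case: x {x0} => a b c d; rewrite /normsqq /= => n0; congr Quat => /=; field.
Qed.

Lemma unitqP x y : y * x = 1 /\ x * y = 1 -> x \in [pred x | x != 0].
Proof.
by move=> [yx _]; rewrite inE; apply/eqP => x0; move: yx;
  rewrite x0 mulr0 => /esym/eqP; rewrite oner_eq0.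
Qed.

Lemma invq_out : {in [predC [pred x : quaternion R | x != 0]], invq =1 id}.
Proof. by move=> x; rewrite !inE negbK /invq => /eqP->; rewrite eqxx. Qed.

HB.instance Definition _ := GRing.NzRing_hasMulInverse.Build (quaternion R)
  mulVq mulqV unitqP invq_out.

Lemma unitqE x : x != 0 -> x \is a GRing.unit.
Proof. by []. Qed.

End QuaternionInverse.

(** * Linear systems and one-sided inverses over a division ring *)

Section DivisionRingMatrix.
Variable D : unitRingType.
Hypothesis unitD : forall x : D, x != 0 -> x \is a GRing.unit.

(** Right linear independence of all the columns of [A]. *)
Definition inj_mx m n (A : 'M[D]_(m, n)) : Prop :=
  forall c : 'cV[D]_n, A *m c = 0 -> c = 0.

(** Gaussian elimination by induction on the number of rows: a zero first column gives a basis
    vector, and otherwise a nonzero entry of it serves as pivot. *)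
Lemma wide_mx_kernel r n (M : 'M[D]_(r, n)) :
  (r < n)%N -> exists2 c : 'cV[D]_n, c != 0 & M *m c = 0.
Proof.
elim: r n M => [|r IHr] [//|n] M.
  move=> _; exists (const_mx 1); last exact: flatmx0.
  by apply/eqP => /colP/(_ ord0); rewrite !mxE => /eqP; rewrite oner_eq0.
rewrite ltnS => rn.
have [M0|[i0 Mi0]] : (forall i, M i 0 = 0) \/ (exists i, M i 0 != 0).
- have [/forallP M0|] := boolP [forall i, M i 0 == 0].
    by left=> i; apply/eqP/M0.
  by rewrite negb_forall => /existsP; right.
- exists (delta_mx 0 0).
    by apply/eqP => /colP/(_ ord0); rewrite !mxE eqxx => /eqP; rewrite oner_eq0.
  by apply/colP => i; rewrite -colE !mxE.
set y := (M i0 0)^-1.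
(* Schur complement of the pivot [M i0 0]: row [i0] and column [0] are eliminated. *)
pose N := \matrix_(i < r, j < n)
  (M (lift i0 i) (lift 0 j) - M (lift i0 i) 0 * y * M i0 (lift 0 j)).
have [c c0 Nc] := IHr n N rn.
pose s := \sum_j M i0 (lift 0 j) * c j 0.
(* Back substitution: the new first entry is the one that solves row [i0]. *)
exists (\col_j oapp (fun j' => c j' 0) (- (y * s)) (unlift 0 j)).
  apply: contra c0 => /eqP/colP c0; apply/eqP/colP => j.
  by have := c0 (lift 0 j); rewrite !mxE liftK.
apply/colP => i; rewrite !mxE big_ord_recl mxE unlift_none /=.
under eq_bigr do rewrite mxE liftK /=.
case: (unliftP i0 i) => [i' ->|->]; last first.
  by rewrite mulrN mulrA mulrV ?unitD// mul1r addNr.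
have /colP/(_ i') := Nc; rewrite !mxE => Nci; rewrite -[RHS]Nci.
under [RHS]eq_bigr do rewrite /N mxE mulrBl -!mulrA.
by rewrite big_split /= sumrN -!mulr_sumr addrC mulrN.
Qed.

(** The [r + 1] columns of [row_mx K v] are dependent; injectivity of [K] makes the coefficient of
    [v] nonzero, so it can be divided out on the right. *)
Lemma inj_mx_surj r (K : 'M[D]_r) (v : 'cV[D]_r) :
  inj_mx K -> exists z, v = K *m z.
Proof.
move=> Ki; have [|c c0] := wide_mx_kernel (row_mx K v).
  by rewrite addn1.
rewrite -(vsubmxK c) mul_row_col; set a := usubmx c; set d := dsubmx c => Kad.
have d0 : d 0 0 != 0.
  apply: contra c0 => /eqP d0; have dE : d = 0.
    by apply/colP => i; rewrite ord1 d0 mxE.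
  move: Kad; rewrite dE mulmx0 addr0 => /Ki a0.
  by rewrite -(vsubmxK c) -/a -/d a0 dE col_mx0.
clearbody a d.
exists (\col_i (- (a i 0 * (d 0 0)^-1))).
apply/colP => i; have /colP/(_ i) := Kad.
rewrite !mxE big_ord1 => /eqP; rewrite addrC addr_eq0 => /eqP vd.
under eq_bigr do rewrite mxE mulrN mulrA.
by rewrite sumrN -mulr_suml -mulNr -vd mulrK// unitD.
Qed.

Lemma inj_mx_rinv r (K : 'M[D]_r) : inj_mx K -> exists L, K *m L = 1%:M.
Proof.
move=> Ki; have /choice[f fE] j := inj_mx_surj (col j 1%:M) Ki.
exists (\matrix_(i, j) f j i 0); apply/matrixP => i j.
have /colP/(_ i) := fE j; rewrite [LHS]mxE => ->.
by rewrite !mxE; apply: eq_bigr => l _; rewrite mxE.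
Qed.

(** [H] is injective because [G] is a left inverse, so it also has a right inverse [L], and then
    [G = G *m H *m L = L]. *)
Lemma mulmx1_comm r (G H : 'M[D]_r) : G *m H = 1%:M -> H *m G = 1%:M.
Proof.
move=> GH; have [|L HL] := @inj_mx_rinv r H.
  by move=> c /(congr1 (mulmx G)); rewrite mulmxA GH mul1mx mulmx0.
suff -> : G = L by [].
by rewrite -[G]mulmx1 -HL mulmxA GH mul1mx.
Qed.

Lemma inj_mx_cancel m n p (A : 'M[D]_(m, n)) (X Y : 'M[D]_(n, p)) :
  inj_mx A -> A *m X = A *m Y -> X = Y.
Proof.
move=> Ai AXY; apply/matrixP => i j; apply/eqP; rewrite -subr_eq0; apply/eqP.
have /Ai/colP/(_ i) : A *m col j (X - Y) = 0.
  by rewrite !colE mulmxA mulmxBr AXY subrr mul0mx.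
by rewrite !mxE.
Qed.

End DivisionRingMatrix.

Lemma mulmx1_expr (R : pzRingType) r (G H : 'M[R]_r) j :
  G *m H = 1%:M -> G ^+ j *m H ^+ j = 1%:M.
Proof.
move=> GH; elim: j => [|j IHj]; first by rewrite !expr0 mulmx1.
by rewrite exprS exprSr -!mulmxE -mulmxA (mulmxA _ _ H) IHj mul1mx.
Qed.

(** * Rank factorization and existence of the Drazin inverse *)

Section Rank.
Variable R : realType.
Local Notation H := (quaternion R).

Lemma qrank_basis m n (A : 'M[H]_(m, n)) :
  exists J : {set 'I_n}, [/\ qrank A = #|J|, right_indep_cols A J
    & forall J' : {set 'I_n}, right_indep_cols A J' -> (#|J'| <= #|J|)%N].
Proof.
have P0 : (0 < #|[pred J : {set 'I_n} | `[< right_indep_cols A J >]]|)%N.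
  apply/card_gt0P; exists finset.set0; rewrite unfold_in /=.
  by apply/asboolP => c _ j; rewrite finset.in_set0.
have [J /asboolP Ji Je] := eq_bigmax_cond (fun J : {set 'I_n} => #|J|) P0.
have {}Je : qrank A = #|J| by exact: Je.
exists J; split=> // J' /asboolP J'i; rewrite -Je.
exact: (leq_bigmax_cond (F := fun J : {set 'I_n} => #|J|) J').
Qed.

(** For [j] outside [J], maximality makes [j |: J] dependent; the coefficient of column [j] is
    nonzero since [J] is independent. *)
Lemma right_indep_cols_span m n (A : 'M[H]_(m, n)) (J : {set 'I_n}) (j : 'I_n) :
    right_indep_cols A J ->
    (forall J' : {set 'I_n}, right_indep_cols A J' -> (#|J'| <= #|J|)%N) ->
  exists c : 'I_n -> H, forall i, A i j = \sum_(l in J) A i l * c l.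
Proof.
move=> Ji Jmax; have [jJ|jJ] := boolP (j \in J).
  exists (fun l => (l == j)%:R) => i; rewrite (bigD1 j)//= eqxx mulr1.
  by rewrite big1 ?addr0// => l /andP[_ /negbTE->]; rewrite mulr0.
have /existsNP[c /not_implyP[Ac nc]] : ~ right_indep_cols A (j |: J)%SET.
  by move=> /Jmax; rewrite finset.cardsU1 jJ ltnn.
have {}Ac i : A i j * c j + \sum_(l in J) A i l * c l = 0.
  by rewrite -[RHS](Ac i) finset.big_setU1.
have cj0 : c j != 0.
  apply/eqP => cj; apply: nc => l; rewrite finset.in_setU1 => /orP[/eqP->//|].
  by apply: Ji => i; have := Ac i; rewrite cj mulr0 add0r.
exists (fun l => - (c l * (c j)^-1)) => i.
under eq_bigr do rewrite mulrN mulrA.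
rewrite sumrN -mulr_suml -mulNr.
have /eqP := Ac i; rewrite addr_eq0 => /eqP <-.
by rewrite mulrK// unitqE.
Qed.

(** [P] selects the columns of a maximal independent set. Keeping the left factor in the form
    [A *m P] lets powers of [A] commute past it later. *)
Lemma qrank_factor m n r (A : 'M[H]_(m, n)) : qrank A = r ->
  exists (P : 'M[H]_(n, r)) (C : 'M[H]_(r, n)),
    inj_mx (A *m P) /\ A = A *m P *m C.
Proof.
have [J [-> Ji Jmax]] := qrank_basis A; move=> <- {r}.
have APE i l : (A *m colsub (@enum_val _ (mem J)) 1%:M) i l = A i (enum_val l).
  by rewrite -[A in LHS]mxsub_id -mxsub_mul mulmx1 mxE.
exists (colsub (@enum_val _ (mem J)) 1%:M).
have /choice[c cE] j := right_indep_cols_span j Ji Jmax.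
exists (\matrix_(l, j) c j (enum_val l)); split.
  (* [x'] extends [x] by zero outside [J]; each sum has at most one term. *)
  move=> x Ax; pose x' j := \sum_(l < #|J| | enum_val l == j) x l 0.
  have x'E l : x' (enum_val l) = x l 0.
    rewrite /x' (bigD1 l)//= big1 ?addr0// => l' /andP[/eqP/enum_val_inj->].
    by rewrite eqxx.
  apply/colP => l; rewrite -x'E mxE; apply: Ji (enum_valP l) => i.
  rewrite big_enum_val; have /colP/(_ i) := Ax; rewrite !mxE => Axi.
  rewrite -[RHS]Axi.
  by apply: eq_bigr => l' _; rewrite APE x'E.
apply/matrixP => i j; rewrite cE big_enum_val mxE.
by apply: eq_bigr => l _; rewrite APE mxE.
Qed.

Lemma qrank_succ_drazin m (A : 'M[H]_m) k :
    qrank (A ^+ k.+1) = qrank (A ^+ k) ->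
  exists X : 'M[H]_m,
    [/\ A ^+ k.+1 *m X = A ^+ k, X *m A *m X = X & A *m X = X *m A].
Proof.
(* A common name [r] for both ranks gives both factorizations the same inner dimension, so [C *m P']
   is square. *)
move: {2}(qrank (A ^+ k)) (erefl (qrank (A ^+ k))) => r Akr Ak.
have [P [C []]] := qrank_factor Akr; rewrite Akr in Ak.
have [P' [_ [P'i _]]] := qrank_factor Ak.
set B := A ^+ k *m P => Bi AkE.
(* Forced by [A *m B = A ^+ k *m A *m P = B *m C *m A *m P]. *)
pose G := C *m A *m P.
have AB : A *m B = B *m G.
  by rewrite /B /G !mulmxA -AkE !mulmxE -exprS -exprSr.
clearbody B G; clear P.
(* [B *m G *m (C *m P')] equals [A ^+ k.+1 *m P'], which is injective. *)
have Gi : inj_mx (G *m (C *m P')).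
  move=> x Gx; apply: P'i; rewrite exprS -mulmxE AkE mulmxA AB.
  by rewrite -!mulmxA in Gx *; rewrite Gx mulmx0.
have [L GL] := inj_mx_rinv (@unitqE R) Gi.
pose N := C *m P' *m L.
have GN : G *m N = 1%:M by rewrite /N mulmxA.
have NG := mulmx1_comm (@unitqE R) GN.
clearbody N.
have CA : C *m A = G *m C.
  apply: (inj_mx_cancel Bi).
  by rewrite !mulmxA -AkE -AB -mulmxA -AkE !mulmxE -exprS -exprSr.
have AjB j : A ^+ j *m B = B *m G ^+ j.
  elim: j => [|j IHj]; first by rewrite !expr0 mul1mx mulmx1.
  by rewrite exprS -mulmxE -mulmxA IHj mulmxA AB -mulmxA mulmxE -exprS.
have CB : C *m B = G ^+ k.
  by apply: (inj_mx_cancel Bi); rewrite mulmxA -AkE AjB.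
have GNk := mulmx1_expr k GN; have NGk := mulmx1_expr k NG.
have AX : A *m (B *m N ^+ k.+1 *m C) = B *m N ^+ k *m C.
  by rewrite !mulmxA AB exprS -mulmxE mulmxA -(mulmxA B G) GN mulmx1.
have XA : (B *m N ^+ k.+1 *m C) *m A = B *m N ^+ k *m C.
  by rewrite -mulmxA CA exprSr -mulmxE !mulmxA -(mulmxA _ N G) NG mulmx1.
exists (B *m N ^+ k.+1 *m C); split; last by rewrite AX XA.
  by rewrite exprSr -mulmxE -mulmxA AX !mulmxA AjB -(mulmxA B) GNk mulmx1 -AkE.
by rewrite XA !mulmxA -(mulmxA _ C B) CB -(mulmxA B) NGk mulmx1.
Qed.

End Rank.

(** * Uniqueness of the Drazin inverse in a ring *)

Section DrazinRing.
Variable T : pzRingType.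
Implicit Types a x y : T.

Lemma outer_exprl a x j : x * a * x = x -> a * x = x * a -> x ^+ j.+1 * a ^+ j = x.
Proof.
move=> xax ax; elim: j => [|j IHj]; first by rewrite expr1 mulr1.
by rewrite exprS [a ^+ _]exprSr -mulrA (mulrA _ (a ^+ j)) IHj -ax mulrA.
Qed.

Lemma outer_exprr a x j : x * a * x = x -> a * x = x * a -> a ^+ j * x ^+ j.+1 = x.
Proof.
move=> xax ax; rewrite -[RHS](outer_exprl j xax ax).
exact/commrX/commr_sym/commrX/commr_sym.
Qed.

(** Writing [y = y ^+ k.+1 * a ^+ k] exposes the factor [a ^+ k.+1 * x]. *)
Lemma drazin_absorb a x y k :
    y * a * y = y -> a * y = y * a -> a ^+ k.+1 * x = a ^+ k ->
  y * a * x = y.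
Proof.
move=> yay ay akx; rewrite -{1}(outer_exprl k yay ay) -[RHS](outer_exprl k yay ay).
by rewrite -(mulrA _ _ a) -exprSr -mulrA akx.
Qed.

(** Both sides equal [y * a * x]: substitute [a ^+ k = y * a ^+ k.+1] in
    [x = a ^+ k * x ^+ k.+1]. *)
Lemma drazin_uniq a x y k :
    [/\ a ^+ k.+1 * x = a ^+ k, x * a * x = x & a * x = x * a] ->
    [/\ a ^+ k.+1 * y = a ^+ k, y * a * y = y & a * y = y * a] ->
  x = y.
Proof.
move=> [akx xax ax] [aky yay ay].
have aky' : y * a ^+ k.+1 = a ^+ k by rewrite -aky; apply/commrX/commr_sym.
rewrite -(drazin_absorb yay ay akx) -[LHS](outer_exprr k xax ax).
by rewrite -[in LHS]aky' [a ^+ k.+1]exprS mulrA -mulrA (outer_exprr k xax ax).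
Qed.

End DrazinRing.

(** * Ranges, null spaces and uniqueness of outer inverses *)

Section RangeNull.
Variable R : realType.
Local Notation H := (quaternion R).

Lemma range_rM m n p (X : 'M[H]_(m, n)) (Y : 'M[H]_(n, p)) :
  range_r (X *m Y) `<=` range_r X.
Proof. by move=> _ [x ->]; exists (Y *m x); rewrite mulmxA. Qed.

Lemma null_rM m n p (X : 'M[H]_(m, n)) (Y : 'M[H]_(n, p)) :
  null_r Y `<=` null_r (X *m Y).
Proof. by move=> x; rewrite /null_r /= -mulmxA => ->; rewrite mulmx0. Qed.

Lemma range_lM m n p (X : 'M[H]_(m, n)) (Y : 'M[H]_(n, p)) :
  range_l (X *m Y) `<=` range_l Y.
Proof. by move=> _ [x ->]; exists (x *m X); rewrite mulmxA. Qed.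

Lemma null_lM m n p (X : 'M[H]_(m, n)) (Y : 'M[H]_(n, p)) :
  null_l X `<=` null_l (X *m Y).
Proof. by move=> x; rewrite /null_l /= mulmxA => ->; rewrite mul0mx. Qed.

Lemma sub_range_r m n p (X : 'M[H]_(m, n)) (Y : 'M[H]_(m, p)) :
  range_r X `<=` range_r Y -> exists Z, X = Y *m Z.
Proof.
move=> XY; have /choice[f fE] j : exists z, col j X = Y *m z.
  by apply: XY; exists (delta_mx j 0); rewrite colE.
exists (\matrix_(i, j) f j i 0); apply/matrixP => i j.
have /colP/(_ i) := fE j; rewrite [LHS]mxE => ->.
by rewrite !mxE; apply: eq_bigr => l _; rewrite mxE.
Qed.

Lemma sub_range_l m n p (X : 'M[H]_(m, n)) (Y : 'M[H]_(p, n)) :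
  range_l X `<=` range_l Y -> exists Z, X = Z *m Y.
Proof.
move=> XY; have /choice[f fE] i : exists z, row i X = z *m Y.
  by apply: XY; exists (delta_mx 0 i); rewrite rowE.
exists (\matrix_(i, j) f i 0 j); apply/matrixP => i j.
have /rowP/(_ j) := fE i; rewrite [LHS]mxE => ->.
by rewrite !mxE; apply: eq_bigr => l _; rewrite mxE.
Qed.

Lemma sub_null_r m n p q (X : 'M[H]_(m, n)) (Y : 'M[H]_(p, n)) (W : 'M[H]_(n, q)) :
  null_r X `<=` null_r Y -> X *m W = 0 -> Y *m W = 0.
Proof.
move=> XY XW; apply/matrixP => i j.
have /XY/colP/(_ i) : null_r X (col j W).
  by rewrite /null_r /= colE mulmxA XW mul0mx.
by rewrite colE mulmxA -colE !mxE.
Qed.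

Lemma sub_null_l m n p q (X : 'M[H]_(n, m)) (Y : 'M[H]_(n, p)) (W : 'M[H]_(q, n)) :
  null_l X `<=` null_l Y -> W *m X = 0 -> W *m Y = 0.
Proof.
move=> XY XW; apply/matrixP => i j.
have /XY/rowP/(_ j) : null_l X (row i W).
  by rewrite /null_l /= rowE -mulmxA XW mulmx0.
by rewrite rowE -mulmxA -rowE !mxE.
Qed.

Lemma outer_r_uniq m n p q (A : 'M[H]_(m, n)) (S : 'M[H]_(n, p))
    (T : 'M[H]_(q, m)) (X Y : 'M[H]_(n, m)) :
  is_outer_r A S T X -> is_outer_r A S T Y -> X = Y.
Proof.
move=> [XAX rX nX] [YAY rY nY].
have [|Z XE] := @sub_range_r _ _ _ X Y; first by rewrite rX rY.
have YAX : Y *m A *m X = X by rewrite XE mulmxA YAY.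
(* The columns of [A *m X - 1%:M] are killed by [X], hence by [Y]. *)
have : Y *m (A *m X - 1%:M) = 0.
  apply: (@sub_null_r _ _ _ _ X); first by rewrite nX nY.
  by rewrite mulmxBr mulmx1 mulmxA XAX subrr.
by rewrite mulmxBr mulmx1 mulmxA YAX => /eqP; rewrite subr_eq0 => /eqP.
Qed.

(** Here the middle term is [X *m A *m Y], since ranges and null spaces consist of rows. *)
Lemma outer_l_uniq m n p q (A : 'M[H]_(m, n)) (S : 'M[H]_(p, m))
    (T : 'M[H]_(n, q)) (X Y : 'M[H]_(n, m)) :
  is_outer_l A S T X -> is_outer_l A S T Y -> X = Y.
Proof.
move=> [XAX rX nX] [YAY rY nY].
have [|Z XE] := @sub_range_l _ _ _ X Y; first by rewrite rX rY.
have XAY : X *m A *m Y = X by rewrite XE -!mulmxA (mulmxA Y) YAY.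
have : (X *m A - 1%:M) *m Y = 0.
  apply: (@sub_null_l _ _ _ _ X); first by rewrite nX nY.
  by rewrite mulmxBl mul1mx XAX subrr.
by rewrite mulmxBl mul1mx XAY => /eqP; rewrite subr_eq0 => /eqP.
Qed.

End RangeNull.

(** * Uniqueness of the index, and the three characterizations combined *)

Lemma has_index_uniq (R : realType) m (A : 'M[quaternion R]_m) k l :
  has_index A k -> has_index A l -> k = l.
Proof.
by move=> [Ak kmin] [Al lmin]; apply/eqP; rewrite eqn_leq kmin// lmin.
Qed.

Theorem theorem4p7 (R : realType) (m : nat) (A : 'M[quaternion R]_m) (k : nat)
    (hk : has_index A k) :
  exists AD : 'M[quaternion R]_m,
    [/\ unique (is_drazin A) AD,
        unique (is_outer_l A (A ^+ k) (A ^+ k)) AD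
      & unique (is_outer_r A (A ^+ k) (A ^+ k)) AD].
Proof.
have [X [AkX XAX AX]] := qrank_succ_drazin hk.1.
have XAk : X *m A ^+ k.+1 = A ^+ k by rewrite -AkX; apply/commrX/commr_sym.
have XEl : X ^+ k.+1 *m A ^+ k = X by exact: outer_exprl.
have XEr : A ^+ k *m X ^+ k.+1 = X by exact: outer_exprr.
have Ol : is_outer_l A (A ^+ k) (A ^+ k) X.
  split=> //; apply/seteqP; split.
  - by rewrite -{1}XEl; exact: range_lM.
  - by rewrite -{1}AkX; exact: range_lM.
  - by rewrite -{1}XAk; exact: null_lM.
  - by rewrite -{1}XEr; exact: null_lM.
have Or : is_outer_r A (A ^+ k) (A ^+ k) X.
  split=> //; apply/seteqP; split.
  - by rewrite -{1}XEr; exact: range_rM.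
  - by rewrite -{1}XAk; exact: range_rM.
  - by rewrite -{1}AkX; exact: null_rM.
  - by rewrite -{1}XEl; exact: null_rM.
exists X; split; split=> //.
- by exists k.
(* [is_drazin] brings its own index [l], which must first be identified with [k]. *)
- move=> Y [l hl]; rewrite (has_index_uniq hl hk) => Yl.
  exact: (drazin_uniq (a := A) (k := k)).
- by move=> Y /(outer_l_uniq Ol).
- by move=> Y /(outer_r_uniq Or).
Qed.
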